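(* Let $q$ be a prime power and let $n,k,\delta$ be integers with $n\geq2k>2\delta>0$. Put $m=n-k$. Then $$\bar{A}_q(n,2\delta,k)\geq q^{(n-k)(k-\delta+1)}+\begin{cases}\displaystyle\sum_{i=\delta}^{k-\delta}A_i(\delta)+1, & k\geq 2\delta;\\[2ex] \displaystyle\max_{1\leq a <\delta}\left\lceil\frac{\sum_{i=1}^{k-\delta}A_i(a)}{q^{m(\delta-a)}-1}\right\rceil, & k<2\delta,\end{cases}$$ where $A_i(x)$ denotes the number of codewords of rank $i$ in an MRD$[(n-k)\times k,x]_q$ code.
   Context: $\mathcal G_q(n,k)$ is the set of $k$-dimensional subspaces of $\mathbb F_q^n$, with subspace distance $d_S(\mathcal U,\mathcal V)=\dim\mathcal U+\dim\mathcal V-2\dim(\mathcal U\cap\mathcal V)$. An $(n,d,k)_q$-CDC is a subset of $\mathcal G_q(n,k)$ with pairwise subspace distance at least $d$. An MRD$[a\times b,\delta]_q$ code is an $\mathbb F_q$-linear subspace of $\mathbb F_q^{a\times b}$ of dimension $\max\{a,b\}(\min\{a,b\}-\delta+1)$ whose nonzero elements all have rank at least $\delta$; the number of codewords of each rank depends only on $a,b,\delta,q$. A lifted MRD code is $\{\mathrm{rowspace}(\boldsymbol I_k\mid\boldsymbol A):\boldsymbol A\in\mathcal D\}$ for an MRD$[k\times(n-k),\delta]_q$ code $\mathcal D$. $\bar A_q(n,2\delta,k)$ denotes the maximum number of codewords of an $(n,2\delta,k)_q$-CDC containing a lifted MRD code as a subset. *)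

(* Defs.v *)
From HB Require Import structures.
From mathcomp Require Import all_boot all_order all_algebra.

Set Implicit Arguments.
Unset Strict Implicit.
Unset Printing Implicit Defensive.

Import Order.TTheory GRing.Theory Num.Theory.
Local Open Scope ring_scope.

(* Over a finite field a vector space has finitely many subspaces; the library
   only provides a choiceType structure on {vspace V}. *)
Section VspaceFinite.
Variables (F : finFieldType) (V : vectType F).

HB.instance Definition _ : isCountable {vspace V} :=
  CanIsCountable (@VectorInternalTheory.vs2mxK F V).
HB.instance Definition _ : isFinite {vspace V} :=
  CanIsFinite (@VectorInternalTheory.vs2mxK F V).

End VspaceFinite.

Definition subspace_dist (F : fieldType) (n : nat)
    (U W : {vspace 'rV[F]_n}) : nat :=
  (\dim U + \dim W - 2 * \dim (U :&: W))%N.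

Definition is_CDC (F : finFieldType) (n d k : nat)
    (C : {set {vspace 'rV[F]_n}}) : bool :=
  [forall U in C, \dim U == k] &&
  [forall U in C, forall W in C, (U != W) ==> (d <= subspace_dist U W)%N].

(* The dimension max(a,b) * (min(a,b) - d + 1), written so that the truncated
   subtraction is exact for every d <= minn a b + 1. *)
Definition is_MRD (F : finFieldType) (a b d : nat)
    (D : {vspace 'M[F]_(a, b)}) : bool :=
  (\dim D == maxn a b * ((minn a b).+1 - d))%N &&
  [forall A in D, (A != 0) ==> (d <= \rank A)%N].

(* The number A_i(d) of codewords of rank i in an MRD[a x b, d] code. This
   number is the same for all such codes, and is read off one of them; the
   default 0%VS is only reached if there is none, which does not happen for
   0 < d <= minn a b. *)
Definition MRD_rank_num (F : finFieldType) (a b d i : nat) : nat :=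
  let D := odflt 0%VS [pick D : {vspace 'M[F]_(a, b)} | is_MRD d D] in
  #|[set A : 'M[F]_(a, b) | (A \in D) && (\rank A == i)]|.

Definition rowspace (F : fieldType) (m n : nat) (M : 'M[F]_(m, n)) :
    {vspace 'rV[F]_n} :=
  <<[seq row i M | i : 'I_m]>>%VS.

(* The subspace rowspace (I_k | A) of F^n. As k + (n - k) and n are not
   convertible, conform_mx is used to recast the width of the matrix; it acts
   as the identity as soon as k <= n. *)
Definition lift_mx (F : fieldType) (n k : nat) (A : 'M[F]_(k, n - k)) :
    {vspace 'rV[F]_n} :=
  rowspace (conform_mx (0 : 'M[F]_(k, n)) (row_mx 1%:M A)).

Definition is_lifted_MRD (F : finFieldType) (n delta k : nat)
    (L : {set {vspace 'rV[F]_n}}) : bool :=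
  [exists D : {vspace 'M[F]_(k, n - k)},
    is_MRD delta D && (L == [set lift_mx A | A in D])].

(* \bar A_q(n, 2 delta, k), with q = #|F|. *)
Definition barA (F : finFieldType) (n delta k : nat) : nat :=
  \max_(C : {set {vspace 'rV[F]_n}} |
        is_CDC (2 * delta) k C &&
        [exists L : {set {vspace 'rV[F]_n}},
          is_lifted_MRD delta k L && (L \subset C)]) #|C|.

(* Main.v *)
(* A set [X] of k x m matrices at pairwise rank distance >= delta, all of rank
   <= k - delta, extends a lifted MRD code {rowspace (I | A)}: writing
   M = (M1 | M2) with M1 square, one adds the subspaces rowspace (M1 | I | M2).
   The meet of two of them projects injectively into the left kernel of the
   difference of the corresponding words of [X], and the meet of rowspace (I | A) with rowspace (M1 | I | M2) projects injectively
   into the row space of M1, whose dimension is at most k - delta.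
   If 2 delta <= k, [X] is made of the words of rank <= k - delta of an
   MRD code of distance delta.  Otherwise, Gabidulin codes give an MRD code of
   distance a containing one of distance delta; no nonzero word of rank
   <= k - delta < delta lies in the smaller code, so these words are spread over
   q^(m (delta - a)) - 1 cosets, one of which supplies [X].
   The rank distribution of an arbitrary MRD code is that of a Gabidulin code,
   because the number of words with row space inside U depends only on dim U, and
   so does the number of words with row space equal to U, by induction. *)

From HB Require Import structures.
Require Import Defs.
From mathcomp Require Import all_boot all_order all_algebra all_field.
From mathcomp Require Import zify.

Set Implicit Arguments.
Unset Strict Implicit.
Unset Printing Implicit Defensive.

Import Order.TTheory GRing.Theory Num.Theory.
Local Open Scope ring_scope.

(** * Extension fields of degree [m] and their Frobenius powers *)

Lemma finField_natr_card_exp (F : finFieldType) (L : fieldExtType F) m :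
  (0 < m)%N -> (#|F| ^ m)%:R = 0 :> L.
Proof.
move=> m0; have [p _ pF] := finPcharP F.
have pL : p \in [pchar L] by rewrite pchar_lalg.
apply/eqP; rewrite -(dvdn_pcharf pL) Euclid_dvdX ?(pcharf_prime pL) // m0 andbT.
have := finNzRing_gt1 F; rewrite (card_pprimeChar pF).
by case: (logn _ _) => // n _; rewrite expnS dvdn_mulr.
Qed.

(** Take a splitting field of ['X^(q ^ m) - 'X]. The roots are the fixed points of the [m]-th
    Frobenius power, which turn out to be all of [L]; separability then gives [q ^ m] elements. *)
Lemma exists_ext_frobenius (F : finFieldType) m : (0 < m)%N ->
  exists (L : fieldExtType F) (phi : nat -> 'End(L)),
    \dim {:L} = m /\ forall i x, phi i x = x ^+ (#|F| ^ i).
Proof.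
move=> m0; pose q := #|F|; have q1 : (1 < q)%N := finNzRing_gt1 F.
have qm1 : (1 < q ^ m)%N by rewrite -(exp1n m) ltn_exp2r.
have size_p (R : nzRingType) : size ('X^(q ^ m) - 'X : {poly R}) = (q ^ m).+1.
  by rewrite size_polyDl size_polyXn // size_polyN size_polyX.
have /FinSplittingFieldFor[L] : 'X^(q ^ m) - 'X != 0 :> {poly F}.
  by rewrite -size_poly_eq0 size_p.
rewrite rmorphB rmorphXn /= map_polyX => -[zs Dp defL].
have [a _ Da] := finField_galois_generator (sub1v {:L}%AS).
have aX i x : (a ^+ i)%g x = x ^+ (q ^ i).
  elim: i x => [|i IHi] x; first by rewrite gal_id.
  by rewrite expgSr expnSr exprM galM ?memvf // IHi Da ?memvf // dimv1 expn1.
have in_zs x : (x \in zs) = ((a ^+ m)%g x == x).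
  by rewrite -root_prod_XsubC -(eqp_root Dp) rootE !hornerE subr_eq0 aX.
(* The fixed space is a subfield containing the roots [zs], and these generate [L]. *)
have fixL : fixedSpace (a ^+ m)%g = {:L}%VS.
  apply/eqP; rewrite eqEsubv subvf -defL -[fixedSpace _]subfield_closed agenvS //.
  rewrite subv_add sub1v; apply/span_subvP => z.
  by rewrite in_zs => /eqP az; apply/fixedSpaceP.
(* The derivative is -1 because [q ^ m] vanishes in [L], so the roots are distinct. *)
have Uzs : uniq zs.
  rewrite -separable_prod_XsubC -(eqp_separable Dp) unlock derivB derivXn derivX.
  rewrite -scaler_nat finField_natr_card_exp // scale0r sub0r.
  by rewrite -(scaleN1r 1) coprimepZr ?coprimep1 // oppr_eq0 oner_eq0.
pose fL := FinFieldExtType L.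
have cardL : #|fL| = (q ^ m)%N.
  apply: succn_inj; rewrite -(size_p L) (eqp_size Dp) (size_prod_XsubC _ id).
  congr _.+1; rewrite -(elimT (@card_uniqP fL zs) Uzs); apply: eq_card => x.
  by rewrite in_zs -(sameP fixedSpaceP eqP) fixL memvf.
exists L, (fun i => (a ^+ i)%g : 'End(L)); split=> //.
apply/eqP; rewrite -(eqn_exp2l _ _ q1) -cardL.
by rewrite -(@card_vspacef F fL (Vector.class L)) card_vspace.
Qed.

(** * Row spaces: membership and dimension *)

Lemma mem_rowspace (F : fieldType) m n (M : 'M[F]_(m, n)) (v : 'rV_n) :
  (v \in rowspace M) = (v <= M)%MS.
Proof.
apply/idP/idP => [|/submxP[u ->]].
  rewrite /rowspace => /coord_span->; apply: summx_sub => i _; apply: scalemx_sub.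
  rewrite -tnth_nth.
  have /imageP[j _ ->] := mem_tnth i (image_tuple (fun j => row j M) 'I_m).
  exact: row_sub.
rewrite mulmx_sum_row memv_suml // => i _; rewrite memvZ // memv_span //.
exact: image_f.
Qed.

Lemma dim_rowspace (F : fieldType) m n (M : 'M[F]_(m, n)) :
  \dim (rowspace M) = \rank M.
Proof.
have -> : rowspace M = rowspace (row_base M).
  by apply/vspaceP => v; rewrite !mem_rowspace eq_row_base.
apply/eqP; rewrite eqn_leq; apply/andP; split.
  by rewrite (leq_trans (dim_span _)) // size_map size_enum_ord.
pose f : 'Hom('rV_(\rank M), 'rV_n) := linfun (mulmxr (row_base M)).
have kf : lker f == 0%VS.
  apply/lker0P => u v; rewrite !lfunE /=.
  exact: (row_free_inj (row_base_free M)).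
rewrite -{1}[\rank M]mul1n -[X in (X <= _)%N](dimvf ('rV[F]_(\rank M))).
rewrite -(limg_dim_eq (f := f)); last by rewrite (eqP kf) capv0.
apply: dimvS; apply/subvP => _ /memv_imgP[u _ ->].
by rewrite lfunE mem_rowspace submxMl.
Qed.

Lemma dim_submx_le (F : fieldType) m n (S : {vspace 'rV[F]_n}) (M : 'M[F]_(m, n)) :
  (forall v, v \in S -> (v <= M)%MS) -> (\dim S <= \rank M)%N.
Proof.
move=> SM; rewrite -dim_rowspace dimvS //.
by apply/subvP => v /SM; rewrite mem_rowspace.
Qed.

(** * Linearized polynomials and Gabidulin codes *)

Lemma card_linearized_roots (L : fieldType) q t (c : 'I_t -> L) (s : seq L) :
  (1 < q)%N -> (exists i, c i != 0) -> uniq s ->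
  (forall x, x \in s -> \sum_i c i * x ^+ (q ^ i) = 0) -> (size s <= q ^ t.-1)%N.
Proof.
move=> q1 [i0 ci0] Us s0; pose P := \sum_i c i *: 'X^(q ^ i) : {poly L}.
(* The exponents [q ^ i] are distinct, so the coefficient at [q ^ i0] is [c i0]. *)
have nzP : P != 0.
  apply: contraNneq ci0 => P0; have := coef0 L (q ^ i0); rewrite -P0 coef_sum.
  rewrite (bigD1 i0) //= coefZ coefXn eqxx mulr1 big1 ?addr0 => [->//|i ne_i].
  by rewrite coefZ coefXn eqn_exp2l // eq_sym val_eqE (negPf ne_i) mulr0.
rewrite -ltnS (@leq_trans (size P)) //.
  apply: max_poly_roots => //; apply/allP => x xs; apply/rootP.
  rewrite horner_sum -[RHS](s0 x xs); apply: eq_bigr => i _.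
  by rewrite hornerZ hornerXn.
apply: (leq_trans (size_sum _ _ _)); apply/bigmax_leqP => i _.
rewrite (leq_trans (size_scale_leq _ _)) // size_polyXn ltnS leq_exp2l //.
by rewrite -ltnS (ltn_predK (ltn_ord i)).
Qed.

Section Gabidulin.
Import passmx.
Variables (F : finFieldType) (L : fieldExtType F) (phi : nat -> 'End(L)).
Hypothesis phiE : forall i x, phi i x = x ^+ (#|F| ^ i).
Local Notation m := (\dim {:L}).
Local Notation e := (vbasis {:L}).
Variable k : nat.

(** A linearized polynomial; the rows of [C] are the coordinate vectors of its coefficients. *)
Definition linearized t (C : 'M[F]_(t, m)) : 'End(L) :=
  \sum_i (amull (vecof e (row i C)) \o phi i)%VF.

(** For [k <= m], column [j] holds the coordinates of the value at the [j]-th basis vector of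
    [L]. *)
Definition gabidulin_word t (C : 'M[F]_(t, m)) : 'M[F]_(m, k) :=
  (lin1_mx (rVof e \o (linearized C \o (vecof e \o
             mulmxr (pid_mx k : 'M_(k, m))))))^T.

Lemma mul_tr_gabidulin_word t (C : 'M[F]_(t, m)) u :
  u *m (gabidulin_word C)^T =
    rVof e (linearized C (vecof e (u *m pid_mx k))).
Proof. by rewrite trmxK mul_rV_lin1. Qed.

Lemma linearizedE t (C : 'M[F]_(t, m)) x :
  linearized C x = \sum_i vecof e (row i C) * x ^+ (#|F| ^ i).
Proof.
by rewrite sum_lfunE; apply: eq_bigr => i _; rewrite comp_lfunE lfunE /= phiE.
Qed.

Fact gabidulin_word_is_linear t : linear (@gabidulin_word t).
Proof.
move=> a C D; apply: trmx_inj; rewrite linearP /=.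
apply/row_matrixP => i; rewrite !rowE mulmxDr -scalemxAr !mul_tr_gabidulin_word.
rewrite -linearP /=; congr (rVof e _); rewrite !linearizedE scaler_sumr.
rewrite -big_split; apply: eq_bigr => j _ /=.
by rewrite !linearP /= mulrDl scalerAl.
Qed.
HB.instance Definition _ t := GRing.isSemilinear.Build F _ _ _ (@gabidulin_word t)
  (GRing.semilinear_linear (@gabidulin_word_is_linear t)).

Hypothesis km : (k <= m)%N.

(** The left kernel of the transposed word embeds into the roots of a nonzero linearized polynomial.
    There are at most [#|F| ^ t.-1] of these, so the kernel has dimension at most [t.-1]. *)
Lemma rank_gabidulin_word t (C : 'M[F]_(t, m)) :
  C != 0 -> (k.+1 - t <= \rank (gabidulin_word C))%N.
Proof.
move=> nzC; rewrite -mxrank_tr; set A := _^T.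
have eB := vbasisP {:L}.
pose f : 'Hom('rV_k, 'rV_m) := linfun (mulmxr A); pose K := lker f.
pose X (u : 'rV_k) := vecof e (u *m pid_mx k).
have X_inj : injective X.
  apply: inj_comp (can_inj (vecofK eB)) _.
  by apply: row_free_inj; rewrite /row_free rank_pid_mx.
have cardK : (#|K| <= #|F| ^ t.-1)%N.
  rewrite cardE -(size_map X).
  apply: (@card_linearized_roots _ _ _ (fun i => vecof e (row i C))).
  - exact: finNzRing_gt1.
  - apply/existsP; apply: contraNT nzC; rewrite negb_exists => /forallP C0.
    apply/eqP/row_matrixP => i; rewrite row0; apply/eqP.
    by rewrite -(vecof_eq0 eB) -[_ == 0]negbK.
  - by rewrite map_inj_uniq ?enum_uniq.
  move=> x /mapP[u]; rewrite mem_enum memv_ker lfunE /= => /eqP uA ->.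
  rewrite -linearizedE; apply/eqP; rewrite -(rVof_eq0 eB).
  by rewrite -mul_tr_gabidulin_word uA.
have dimK : (\dim K <= t.-1)%N.
  by rewrite -(leq_exp2l _ _ (finNzRing_gt1 F)) -card_vspace.
have dimA : (\dim (limg f) <= \rank A)%N.
  apply: dim_submx_le => _ /memv_imgP[u _ ->].
  by rewrite lfunE submxMl.
have := limg_ker_dim f fullv.
have -> : \dim {:'rV[F]_k} = k by rewrite dimvf /dim /= mul1n.
rewrite capfv -/K => dk.
have t0 : (0 < t)%N.
  by have [i _] := matrix0Pn _ nzC; apply: leq_ltn_trans (ltn_ord i).
rewrite leq_subLR -(prednK t0) addSn ltnS.
by rewrite -[leqLHS]dk leq_add.
Qed.

Definition gabidulin t := limg (linfun (@gabidulin_word t)).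

Lemma gabidulin_rank t A : A \in gabidulin t -> A != 0 -> (k.+1 - t <= \rank A)%N.
Proof.
case/memv_imgP => C _ ->; rewrite lfunE /= => nzA; apply: rank_gabidulin_word.
by apply: contraNneq nzA => ->; rewrite linear0.
Qed.

(** For [t <= k] the rank bound is positive, so encoding is injective. *)
Lemma dim_gabidulin t : (t <= k)%N -> \dim (gabidulin t) = (m * t)%N.
Proof.
move=> tk; rewrite limg_dim_eq ?dimvf /dim /= 1?mulnC //.
apply/eqP; rewrite capfv -subv0; apply/subvP => C; rewrite memv_ker lfunE /= memv0.
apply: contraLR => /rank_gabidulin_word rC; apply: contraTneq rC => ->.
by rewrite mxrank0 -ltnNge subn_gt0 ltnS.
Qed.

Lemma gabidulinS s t : (s <= t)%N -> (gabidulin s <= gabidulin t)%VS.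
Proof.
move=> /subnKC<-; move: (t - s)%N => r; apply/subvP => _ /memv_imgP[C _ ->].
(* Zero coefficients at the higher powers leave the polynomial unchanged. *)
apply/memv_imgP; exists (col_mx C 0); rewrite ?memvf // !lfunE /=.
apply: trmx_inj; apply/row_matrixP => i; rewrite !rowE !mul_tr_gabidulin_word.
congr (rVof e _); rewrite !linearizedE big_split_ord /=.
rewrite [X in _ = _ + X]big1 ?addr0 => [|j _]; last first.
  by rewrite rowKd row0 linear0 mul0r.
by apply: eq_bigr => j _; rewrite rowKu.
Qed.

End Gabidulin.

Lemma exists_MRD_chain (F : finFieldType) m k : (0 < k <= m)%N ->
  exists G : nat -> {vspace 'M[F]_(m, k)},
    (forall d, (0 < d <= k)%N -> is_MRD d (G d)) /\
    (forall d d', (d <= d')%N -> (G d' <= G d)%VS).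
Proof.
case/andP => k0 km; have m0 := leq_trans k0 km.
have [L [phi [dimL phiE]]] := exists_ext_frobenius F m0; case: m / dimL km m0 => km m0.
(* Distance [d] comes from [k.+1 - d] coefficients, so larger distances give smaller codes. *)
exists (fun d => gabidulin phi k (k.+1 - d)); split=> [d /andP[d0 dk]|d d' dd'].
  have tk : (k.+1 - d <= k)%N by rewrite leq_subLR -add1n leq_add2r.
  rewrite /is_MRD (dim_gabidulin phiE km tk) (maxn_idPl km) (minn_idPr km) eqxx /=.
  apply/forall_inP => A GA; apply/implyP => /(gabidulin_rank phiE km GA).
  by rewrite subKn // (leq_trans dk).
by apply: (gabidulinS phiE); rewrite leq_sub2l.
Qed.

(** * Rank distribution of MRD codes *)

Definition mx_sub_vspace (F : fieldType) m p k (U : 'M[F]_(p, k)) :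
    {vspace 'M[F]_(m, k)} :=
  limg (linfun (mulmxr (row_base U)) : 'Hom('M[F]_(m, \rank U), 'M[F]_(m, k))).

Lemma mem_mx_sub_vspace (F : fieldType) m p k (U : 'M[F]_(p, k)) (A : 'M_(m, k)) :
  (A \in mx_sub_vspace m U) = (A <= U)%MS.
Proof.
rewrite -(eq_row_base U); apply/memv_imgP/submxP => [[B _ ->]|[B ->]]; exists B;
  by rewrite ?memvf ?lfunE.
Qed.

Lemma dim_mx_sub_vspace (F : fieldType) m p k (U : 'M[F]_(p, k)) :
  \dim (mx_sub_vspace m U) = (m * \rank U)%N.
Proof.
rewrite limg_dim_eq ?dimvf //; apply/eqP; rewrite capfv.
by apply/lker0P => B C; rewrite !lfunE /=; apply: (row_free_inj (row_base_free U)).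
Qed.

(* The Singleton bound inside the matrices with row space in [U]: such a code
   meets trivially the matrices with row space in a (d-1)-dimensional subspace
   of [U]. *)
Lemma dim_rank_code_le (F : fieldType) m p k d (U : 'M[F]_(p, k))
    (S : {vspace 'M[F]_(m, k)}) :
  (0 < d)%N -> (S <= mx_sub_vspace m U)%VS ->
  (forall A, A \in S -> A != 0 -> (d <= \rank A)%N) ->
  (\dim S <= m * ((\rank U).+1 - d))%N.
Proof.
move=> d0 SU Sd; have [rd|dr] := ltnP (\rank U) d.
  suff -> : S = 0%VS by rewrite dimv0.
  apply/eqP; rewrite -subv0; apply/subvP => A AS; rewrite memv0.
  apply: contraLR rd => /(Sd _ AS) dA; rewrite -leqNgt (leq_trans dA) // mxrankS //.
  by rewrite -mem_mx_sub_vspace (subvP SU).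
pose U' := (pid_mx d.-1 : 'M_(\rank U)) *m row_base U.
have rU' : \rank U' = d.-1.
  rewrite mxrankMfree ?row_base_free // rank_pid_mx //; lia.
have cap0 : (S :&: mx_sub_vspace m U')%VS = 0%VS.
  apply/eqP; rewrite -subv0; apply/subvP => A; rewrite memv_cap mem_mx_sub_vspace memv0.
  case/andP => AS /mxrankS; rewrite rU'; apply: contraTT => /(Sd _ AS); lia.
have : (\dim (S + mx_sub_vspace m U') <= \dim (mx_sub_vspace m U))%N.
  apply: dimvS; rewrite subv_add SU; apply/subvP => A.
  rewrite !mem_mx_sub_vspace => /submx_trans; apply.
  by rewrite (submx_trans (submxMl _ _)) // eq_row_base.
have := dimv_sum_cap S (mx_sub_vspace m U'); rewrite cap0 dimv0 addn0 => ->.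
rewrite !dim_mx_sub_vspace rU'; nia.
Qed.

(* For [\rank U < d] the truncated exponent is 0: only the zero word remains. *)
Lemma MRD_card_sub (F : finFieldType) m k d p (U : 'M[F]_(p, k))
    (D : {vspace 'M[F]_(m, k)}) :
  (k <= m)%N -> (0 < d <= k)%N -> is_MRD d D ->
  #|[set A in D | (A <= U)%MS]| = (#|F| ^ (m * ((\rank U).+1 - d)))%N.
Proof.
move=> km /andP[d0 dk] /andP[/eqP dimD /forall_inP Dd].
have -> : [set A in D | (A <= U)%MS] = [set A in (D :&: mx_sub_vspace m U)%VS].
  by apply/setP => A; rewrite !inE memv_cap mem_mx_sub_vspace.
rewrite cardsE card_vspace; congr (_ ^ _)%N; apply/eqP; rewrite eqn_leq.
apply/andP; split.
  apply: dim_rank_code_le => // [|A]; first exact: capvSr.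
  by rewrite memv_cap => /andP[/Dd/implyP].
have [rd|dr] := ltnP (\rank U) d; first by move: rd; rewrite -subn_eq0 => /eqP->; lia.
(* Lower bound by the dimension formula: the sum of [D] and [mx_sub_vspace m U] has dimension at
   most [m * k]. *)
rewrite -(leq_add2r (m * k)).
have -> : (m * ((\rank U).+1 - d) + m * k = m * (k.+1 - d) + m * \rank U)%N.
  by rewrite -!mulnDr; congr (_ * _)%N; lia.
rewrite -dim_mx_sub_vspace; move: dimD; rewrite (maxn_idPl km) (minn_idPr km) => <-.
rewrite -dimv_sum_cap addnC leq_add2l.
by rewrite (leq_trans (dimvS (subvf _))) // dimvf.
Qed.

(** Both codes have equally many words with row space inside [V]. By induction on the rank the
    proper subspaces contribute equally, and subtracting them leaves the term at [V]. *)
Lemma MRD_card_rowspace_eq (F : finFieldType) m k d (V : 'M[F]_k)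
    (D D' : {vspace 'M[F]_(m, k)}) :
  (k <= m)%N -> (0 < d <= k)%N -> is_MRD d D -> is_MRD d D' ->
  #|[set A in D | <<A>>%MS == V]| = #|[set A in D' | <<A>>%MS == V]|.
Proof.
move=> km dk MD MD'; move: {2}_.+1 (ltnSn (\rank V)) => r.
elim: r V => // r IHr V; rewrite ltnS => rV.
(* Only canonical matrices, those with [<<W>>%MS = W], contribute, so a sum over all [W] counts each
   row space once. *)
have g0 (E : {vspace 'M[F]_(m, k)}) (W : 'M_k) : <<W>>%MS != W ->
    #|[set A in E | <<A>>%MS == W]| = 0.
  move=> nW; apply/eqP; rewrite cards_eq0 -subset0; apply/subsetP => A; rewrite !inE.
  by case/andP => _; apply: contraTT => _; apply: contraNneq nW => <-; rewrite genmx_id.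
have [genV|nV] := eqVneq <<V>>%MS V; last by rewrite !g0.
have fE (E : {vspace 'M[F]_(m, k)}) : #|[set A in E | (A <= V)%MS]| =
    (\sum_(W : 'M_k | (W <= V)%MS) #|[set A in E | <<A>>%MS == W]|)%N.
  rewrite -sum1_card (partition_big (fun A => <<A>>%MS) (fun W => (W <= V)%MS)) /=.
    apply: eq_bigr => W WV; rewrite sum1dep_card; apply: eq_card => A; rewrite !inE.
    apply: andb_id2r => /eqP AW; rewrite andb_idr // => _.
    by rewrite -(genmxE A) AW.
  by move=> A; rewrite inE => /andP[_]; rewrite genmxE.
have := fE D; rewrite (MRD_card_sub _ km dk MD) -(MRD_card_sub V km dk MD') fE.
rewrite (bigD1 V) //= [X in _ = X](bigD1 V) //=.
rewrite (eq_bigr (fun W => #|[set A in D | <<A>>%MS == W]|)) => [/addIn/esym//|W].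
case/andP => WV neWV; have [genW|nW] := eqVneq <<W>>%MS W; last by rewrite !g0.
apply/esym/IHr/(leq_trans _ rV); rewrite (ltn_leqif (mxrank_leqif_sup WV)).
apply: contra neWV => VW; rewrite -genV -genW; apply/eqP/genmxP.
by rewrite WV.
Qed.

(** Words are grouped by row space. [D] witnesses that the [pick] succeeds, so its default never
    arises. *)
Lemma MRD_rank_numE (F : finFieldType) m k d i (D : {vspace 'M[F]_(m, k)}) :
  (k <= m)%N -> (0 < d <= k)%N -> is_MRD d D ->
  MRD_rank_num F m k d i = #|[set A in D | \rank A == i]|.
Proof.
move=> km dk MD; rewrite /MRD_rank_num; case: pickP => [D' MD'|/(_ D)]; last by rewrite MD.
have gE (E : {vspace 'M[F]_(m, k)}) : #|[set A in E | \rank A == i]| =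
    (\sum_(W : 'M_k | \rank W == i) #|[set A in E | <<A>>%MS == W]|)%N.
  rewrite -sum1_card (partition_big (fun A => <<A>>%MS) (fun W => \rank W == i)) /=.
    apply: eq_bigr => W rW; rewrite sum1dep_card; apply: eq_card => A; rewrite !inE.
    apply: andb_id2r => /eqP AW; rewrite andb_idr // => _.
    by rewrite -(genmxE A) AW.
  by move=> A; rewrite inE => /andP[_]; rewrite genmxE.
rewrite /= gE [RHS]gE; apply: eq_bigr => W _; exact: MRD_card_rowspace_eq MD' MD.
Qed.

(** * Constant-dimension codes from two liftings *)

Lemma dim_submx_proj_le (F : fieldType) k n p (G : 'M[F]_(k, n)) (P : 'M_(n, k))
    (S : {vspace 'rV[F]_n}) (M : 'M_(p, k)) :
  G *m P = 1%:M -> (S <= rowspace G)%VS ->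
  (forall v, v \in S -> (v *m P <= M)%MS) -> (\dim S <= \rank M)%N.
Proof.
move=> GP SG SM; pose f : 'Hom('rV_n, 'rV_k) := linfun (mulmxr P).
rewrite -(limg_dim_eq (f := f)).
  by apply: dim_submx_le => _ /memv_imgP[v vS ->]; rewrite lfunE SM.
(* As [P] is a right inverse of [G], multiplication by [P] is injective on [rowspace G]. *)
apply/eqP; rewrite -subv0; apply/subvP => v; rewrite memv_cap memv_ker lfunE /= memv0.
case/andP => /(subvP SG); rewrite mem_rowspace => /submxP[x ->].
by rewrite -mulmxA GP mulmx1 => /eqP->; rewrite mul0mx.
Qed.

(** A common vector is [x *m G = y *m H]; applying [P] gives [x = y], which lies in the left kernel
    of [G - H]. *)
Lemma dim_cap_rowspace_sub (F : fieldType) k n (G H : 'M[F]_(k, n)) (P : 'M_(n, k)) :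
  G *m P = 1%:M -> H *m P = 1%:M ->
  (\dim (rowspace G :&: rowspace H) <= k - \rank (G - H)%R)%N.
Proof.
move=> GP HP; rewrite -mxrank_ker; apply: (dim_submx_proj_le GP (capvSl _ _)) => v.
rewrite memv_cap !mem_rowspace => /andP[/submxP[x ->] /submxP[y]] xy.
have {}xy' : x = y by rewrite -[x]mulmx1 -GP mulmxA xy -mulmxA HP mulmx1.
by rewrite -mulmxA GP mulmx1; apply/sub_kermxP; rewrite mulmxBr xy xy' subrr.
Qed.

Lemma dim_cap_rowspace_mul (F : fieldType) k n (G H : 'M[F]_(k, n)) (P : 'M_(n, k)) :
  G *m P = 1%:M -> (\dim (rowspace G :&: rowspace H) <= \rank (H *m P)%R)%N.
Proof.
move=> GP; apply: (dim_submx_proj_le GP (capvSl _ _)) => v.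
by rewrite memv_cap !mem_rowspace => /andP[_ /submxMr->].
Qed.

Lemma CDC_imset (F : finFieldType) n k delta (T : finType)
    (f : T -> {vspace 'rV[F]_n}) (Z : {set T}) :
  (0 < delta <= k)%N ->
  {in Z, forall s, \dim (f s) = k} ->
  {in Z &, forall s t, s != t -> \dim (f s :&: f t) <= k - delta}%N ->
  is_CDC (2 * delta) k (f @: Z) /\ #|f @: Z| = #|Z|.
Proof.
move=> dk dimf capf; split.
  apply/andP; split.
    by apply/forall_inP => _ /imsetP[s sZ ->]; rewrite dimf.
  apply/forall_inP => _ /imsetP[s sZ ->]; apply/forall_inP => _ /imsetP[t tZ ->].
  apply/implyP => nfst; have nst : s != t by apply: contraNneq nfst => ->.
  by rewrite /subspace_dist !dimf //; move: (\dim _) (capf _ _ sZ tZ nst); lia.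
(* Equal images would meet in dimension [k], which exceeds [k - delta]. *)
apply: card_in_imset => s t sZ tZ fst; apply/eqP; apply: contraT => nst.
by have := capf _ _ sZ tZ nst; rewrite fst capvv dimf //; lia.
Qed.

(* [mu A] is the matrix (A1 | I | A2), where A = (A1 | A2) with A1 square. *)
Lemma exists_second_lift (F : fieldType) k m n : (k + m)%N = n -> (k <= m)%N ->
  let lam A := conform_mx (0 : 'M[F]_(k, n)) (row_mx 1%:M A) in
  exists (mu : 'M[F]_(k, m) -> 'M[F]_(k, n)) (P1 P2 : 'M_(n, k)) (Q1 Q2 : 'M_(n, m))
         (R : 'M_(m, k)),
    [/\ forall A, lam A *m P1 = 1%:M, forall A, lam A *m Q1 = A,
        forall A, mu A *m P2 = 1%:M, forall A, mu A *m Q2 = A &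
        forall A, mu A *m P1 = A *m R].
Proof.
move=> <- /subnKC<-; move: (m - k)%N => r lam.
exists (fun A => row_mx (lsubmx A) (row_mx 1%:M (rsubmx A))).
(* [P1] and [P2] select the identity blocks, [Q1] and [Q2] recover [A], and [R] keeps its first [k]
   columns. *)
exists (col_mx 1%:M 0), (col_mx 0 (col_mx 1%:M 0)), (col_mx 0 1%:M).
exists (col_mx (row_mx 1%:M 0) (col_mx 0 (row_mx 0 1%:M))), (col_mx 1%:M 0).
split=> A.
- by rewrite /lam conform_mx_id mul_row_col mulmx1 mulmx0 addr0.
- by rewrite /lam conform_mx_id mul_row_col mulmx1 mulmx0 add0r.
- by rewrite !mul_row_col mulmx1 !mulmx0 addr0 add0r.
- rewrite !mul_row_col !mul_mx_row !mulmx0 !mulmx1 add0r add_row_mx.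
  by rewrite addr0 add0r hsubmxK.
- by rewrite -[in RHS](hsubmxK A) !mul_row_col !mulmx1 !mulmx0.
Qed.

Lemma barA_ge (F : finFieldType) n k delta (D : {vspace 'M[F]_(k, n - k)})
    (X : {set 'M[F]_(k, n - k)}) :
  (2 * k <= n)%N -> (0 < delta <= k)%N -> is_MRD delta D ->
  {in X &, forall A B, A != B -> delta <= \rank (A - B)%R}%N ->
  {in X, forall A, \rank A <= k - delta}%N ->
  (#|[set A in D]| + #|X| <= barA F n delta k)%N.
Proof.
move=> kn dk MD Xd Xr.
have [||mu [P1 [P2 [Q1 [Q2 [R [GP GQ HP HQ HR]]]]]]] :=
  @exists_second_lift F k (n - k) n; [lia|lia|].
pose lam (A : 'M_(k, n - k)) := conform_mx (0 : 'M[F]_(k, n)) (row_mx 1%:M A).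
have {}GP A : lam A *m P1 = 1%:M by apply: GP.
have {}GQ A : lam A *m Q1 = A by apply: GQ.
have rank_ge (g : 'M[F]_(k, n - k) -> 'M[F]_(k, n)) Q A B : (forall A, g A *m Q = A) ->
    (\rank (A - B)%R <= \rank (g A - g B)%R)%N.
  by move=> gQ; rewrite -{1}[A]gQ -{1}[B]gQ -mulmxBl mxrankM_maxl.
(* The tagged sum keeps the two liftings apart; that their subspaces differ follows from the bound
   on the meets. *)
pose f (x : 'M[F]_(k, n - k) + 'M[F]_(k, n - k)) :=
  rowspace (match x with inl A => lam A | inr A => mu A end).
pose Z := [set inl A | A in D] :|: [set inr A | A in X].
have cardZ : #|Z| = (#|[set A in D]| + #|X|)%N.
  rewrite cardsU (_ : _ :&: _ = set0) ?cards0 ?subn0.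
    by rewrite !card_imset ?cardsE // => A B [].
  by apply/setP => x; rewrite !inE; apply/andP => -[/imsetP[A _ ->] /imsetP[]].
have rank_k (G : 'M[F]_(k, n)) P : G *m P = 1%:M -> \rank G = k.
  move=> GP1; apply/eqP; rewrite eqn_leq rank_leq_row /=.
  by have := mxrankM_maxl G P; rewrite GP1 mxrank1.
have DdE A B : A \in D -> B \in D -> A != B -> (delta <= \rank (A - B)%R)%N.
  move=> AD BD nAB; case/andP: MD => _ /forall_inP/(_ (A - B)).
  by rewrite memvB // subr_eq0 nAB => /(_ isT).
have [||CDC cardC] := @CDC_imset F n k delta _ f Z dk.
- move=> s; rewrite inE => /orP[] /imsetP[A _ ->]; rewrite dim_rowspace.
    exact: rank_k (GP A).
  exact: rank_k (HP A).
- move=> s t; rewrite !inE => /orP[] /imsetP[A AZ ->] /orP[] /imsetP[B BZ ->] neAB.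
  + rewrite (leq_trans (dim_cap_rowspace_sub (GP A) (GP B))) // leq_sub2l //.
    by rewrite (leq_trans _ (rank_ge _ _ _ _ GQ)) // DdE //; apply: contraNneq neAB => ->.
  (* Mixed pair: [P1] sends [mu B] to the first block of [B], of rank at most [\rank B]. *)
  + rewrite (leq_trans (dim_cap_rowspace_mul _ (GP A))) // HR.
    by rewrite (leq_trans (mxrankM_maxl _ _)) // Xr.
  + rewrite capvC (leq_trans (dim_cap_rowspace_mul _ (GP B))) // HR.
    by rewrite (leq_trans (mxrankM_maxl _ _)) // Xr.
  + rewrite (leq_trans (dim_cap_rowspace_sub (HP A) (HP B))) // leq_sub2l //.
    by rewrite (leq_trans _ (rank_ge _ _ _ _ HQ)) // Xd //; apply: contraNneq neAB => ->.
rewrite -cardZ -cardC /barA; apply: leq_bigmax_cond; rewrite CDC /=.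
apply/existsP; exists [set lift_mx A | A in D]; apply/andP; split.
  by apply/existsP; exists D; rewrite MD eqxx.
apply/subsetP => _ /imsetP[A AD ->]; apply/imsetP; exists (inl A) => //.
by rewrite inE; apply/orP; left; apply: imset_f.
Qed.

Lemma is_MRD_tr (F : finFieldType) m k d (D : {vspace 'M[F]_(m, k)}) :
  is_MRD d D -> is_MRD d (linfun (@trmx F m k) @: D)%VS.
Proof.
case/andP => /eqP dimD /forall_inP Dd; apply/andP; split.
  rewrite limg_dim_eq ?dimD 1?maxnC 1?minnC //; apply/eqP; rewrite -subv0.
  apply/subvP => A; rewrite memv_cap memv_ker lfunE /= memv0 => /andP[_].
  by rewrite -(inj_eq trmx_inj) trmx0 trmxK.
apply/forall_inP => _ /memv_imgP[A AD ->]; rewrite lfunE /= mxrank_tr.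
by rewrite -(inj_eq trmx_inj) trmxK trmx0 Dd.
Qed.

Lemma MRD_dist (F : finFieldType) m k d (D : {vspace 'M[F]_(m, k)}) A B :
  is_MRD d D -> A - B \in D -> A != B -> (d <= \rank (A - B)%R)%N.
Proof. by case/andP => _ /forall_inP Dd /Dd; rewrite subr_eq0 => /implyP. Qed.

(** Transposition links the two conventions: ranks are counted in [n - k] by [k] codes, while
    lifting uses [k] by [n - k] matrices. *)
Lemma barA_ge_tr (F : finFieldType) n k delta (D : {vspace 'M[F]_(n - k, k)})
    (X : {set 'M[F]_(n - k, k)}) :
  (2 * k <= n)%N -> (0 < delta <= k)%N -> is_MRD delta D ->
  {in X &, forall A B, A != B -> delta <= \rank (A - B)%R}%N ->
  {in X, forall A, \rank A <= k - delta}%N ->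
  (#|F| ^ ((n - k) * (k - delta + 1)) + #|X| <= barA F n delta k)%N.
Proof.
move=> kn dk MD Xd Xr; have MDt := is_MRD_tr MD.
have Xtd : {in [set A^T | A in X] &, forall A B, A != B -> delta <= \rank (A - B)%R}%N.
  move=> _ _ /imsetP[A AX ->] /imsetP[B BX ->] nAB.
  by rewrite -linearB mxrank_tr Xd //; apply: contraNneq nAB => ->.
have Xtr : {in [set A^T | A in X], forall A, \rank A <= k - delta}%N.
  by move=> _ /imsetP[A AX ->]; rewrite mxrank_tr Xr.
have := barA_ge kn dk MDt Xtd Xtr; rewrite (card_imset _ (@trmx_inj _ _ _)) cardsE.
rewrite card_vspace; case/andP: MDt => /eqP-> _.
by rewrite (maxn_idPr _) ?(minn_idPl _) ?addn1 ?subSn //; lia.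
Qed.

(** * Counting words by rank and by coset *)

Lemma sum_card_rank (F : finFieldType) m k a b (D : {vspace 'M[F]_(m, k)}) :
  (\sum_(a <= i < b) #|[set A in D | \rank A == i]| =
     #|[set A in D | (a <= \rank A < b)%N]|)%N.
Proof.
elim: b => [|b IHb].
  rewrite big_geq //; apply/esym/eqP; rewrite cards_eq0; apply/eqP/setP => A.
  by rewrite !inE ltn0 !andbF.
have [ab|ba] := leqP a b; last first.
  rewrite big_geq //; apply/esym/eqP; rewrite cards_eq0; apply/eqP/setP => A.
  by rewrite !inE; apply/andP => -[_]; lia.
rewrite big_nat_recr //= IHb.
rewrite -[RHS](cardsID [set A : 'M_(m, k) | (\rank A < b)%N]); congr (_ + _)%N.
  by apply: eq_card => A; rewrite !inE -andbA; congr (_ && _); lia.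
by apply: eq_card => A; rewrite !inE andbCA; congr (_ && _); lia.
Qed.

(* Pigeonhole over the nontrivial cosets of [U] in [V]. *)
Lemma exists_large_coset (F : finFieldType) m k (U V : {vspace 'M[F]_(m, k)})
    (S : {set 'M[F]_(m, k)}) :
  (U <= V)%VS -> (\dim U < \dim V)%N -> {subset S <= V} -> (forall A, A \in S -> A \notin U) ->
  exists X : {set 'M[F]_(m, k)},
    [/\ X \subset S, {in X &, forall A B, (A - B)%R \in U} &
        #|S| <= #|X| * (#|F| ^ (\dim V - \dim U) - 1)]%N.
Proof.
move=> UV ltUV SV SU; pose f := (\1 - projv U)%VF.
have kerf : lker f = U.
  apply/vspaceP => A; rewrite memv_ker !lfunE /= id_lfunE opp_lfunE subr_eq0.
  by apply/eqP/idP => [->|/projv_id //]; apply: memv_proj.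
(* As [f] has kernel [U], its nonzero values on [V] label the nontrivial cosets. *)
pose T := (f @: V)%VS; pose T' := [set y in T | y != 0].
have dimT : \dim T = (\dim V - \dim U)%N.
  by rewrite -(limg_ker_dim f V) kerf (capv_idPr UV) addKn.
have cardT' : #|T'| = (#|F| ^ (\dim V - \dim U) - 1)%N.
  rewrite -dimT -card_vspace [#|T|](cardD1 0) mem0v add1n subn1 /=.
  by apply: eq_card => y; rewrite !inE andbC.
have T'0 : (0 < #|T'|)%N.
  rewrite cardT' subn_gt0 -{1}(exp1n (\dim V - \dim U)) ltn_exp2r ?finNzRing_gt1 //.
  by rewrite subn_gt0.
have fS A : A \in S -> f A \in T'.
  by move=> AS; rewrite inE memv_img ?SV // -memv_ker kerf SU.
pose X y := [set A in S | f A == y].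
have [y yT' Xmax] := eq_bigmax_cond (fun y => #|X y|) T'0.
exists (X y); split; first by apply/subsetP => A; rewrite inE => /andP[].
  move=> A B; rewrite !inE => /andP[_ /eqP fA] /andP[_ /eqP fB].
  by rewrite -kerf memv_ker linearB /= fA fB subrr.
rewrite -Xmax mulnC -cardT' -sum_nat_const -sum1_card (partition_big f (mem T')) //=.
apply: leq_sum => z zT'; rewrite sum1dep_card -/(X z).
exact: (@leq_bigmax_cond _ (fun y => y \in T') (fun y => #|X y|)).
Qed.

(** Passes from the rational ceiling to a count; the ratio is nonnegative, so the absolute value
    changes nothing. *)
Lemma abs_ceil_ratio_le (s c N : nat) :
  (1 < N)%N -> (s <= c * (N - 1))%N ->
  (`|Num.ceil (s%:R / (N%:R - 1) : rat)| <= c)%N.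
Proof.
move=> N1 sc; have N0 : 0 < N%:R - 1 :> rat by rewrite subr_gt0 ltr1n.
set x := _ / _; have x0 : 0 <= x by rewrite divr_ge0 ?ler0n // ltW.
have cx0 : 0 <= Num.ceil x by rewrite ceil_ge0 // (lt_le_trans _ x0) // ltrN10.
rewrite -lez_nat gez0_abs // ceil_le_int ler_pdivrMr //.
have -> : N%:R - 1 = (N - 1)%:R :> rat by rewrite natrB // ltnW.
by rewrite -pmulrn -natrM ler_nat.
Qed.

(* The lower bound in the two ranges of [delta] *)
Local Close Scope ring_scope.
Local Open Scope nat_scope.

Theorem theorem2p7 (F : finFieldType) (q n k delta : nat)
    (hq : #|F| = q) (hn : 2 * k <= n) (hk : 2 * delta < 2 * k)
    (hd : 0 < 2 * delta) :
  let m := n - k in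
  let A (x i : nat) := MRD_rank_num F m k x i in
  q ^ ((n - k) * (k - delta + 1)) +
    (if 2 * delta <= k then
       \sum_(delta <= i < (k - delta).+1) A delta i + 1
     else
       \max_(1 <= a < delta)
         `|Num.ceil ((\sum_(1 <= i < (k - delta).+1) A a i)%:R
                     / (q%:R ^+ (m * (delta - a)) - 1) : rat)%R|)
  <= barA F n delta k.
Proof.
case: q / hq; cbv beta zeta; set m := n - k.
have km : k <= m by rewrite /m; lia.
have k0 : 0 < k <= m by lia.
have dk : 0 < delta <= k by lia.
have [G [MG GS]] := exists_MRD_chain F k0.
have MD := MG _ dk.
have sumA a b c : 0 < a <= k ->
    \sum_(b <= i < c) MRD_rank_num F m k a i = #|[set M in G a | b <= \rank M < c]|.
  move=> ak; rewrite -sum_card_rank; apply: eq_bigr => i _.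
  exact: (MRD_rank_numE i km ak (MG _ ak)).
case: ifP => [dk2|ndk2].
  rewrite sumA //.
  (* The zero matrix supplies the summand 1; it is outside [Z] because [delta > 0]. *)
  set Z := [set _ in _ | _]; have Z0 : 0%R \notin Z by rewrite inE mxrank0; lia.
  have <- : #|0%R |: Z| = #|Z| + 1 by rewrite cardsU1 Z0 addnC.
  have ZG M : M \in 0%R |: Z -> M \in G delta.
    by rewrite !inE => /orP[/eqP->|/andP[]//]; rewrite mem0v.
  apply: (barA_ge_tr hn dk MD) => [M N /ZG MZ /ZG NZ|M].
    by apply: (MRD_dist MD); rewrite memvB.
  by rewrite !inE => /orP[/eqP->|/and3P[]//]; rewrite mxrank0.
set base := #|F| ^ _.
(* With [X] empty this bounds [base] itself, so [base] can be moved across and each [a] treated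
   separately. *)
have base_le : base <= barA F n delta k.
  have := barA_ge_tr (X := set0) hn dk MD; rewrite cards0 addn0; apply.
    by move=> M N; rewrite inE.
  by move=> M; rewrite inE.
rewrite -leq_subRL // big_seq; apply/bigmax_leqP_seq => a; rewrite mem_index_iota.
move=> /andP[a1 ad] _; rewrite leq_subRL //.
have ak : 0 < a <= k by lia.
have dimG b : 0 < b <= k -> \dim (G b) = m * (k.+1 - b).
  by move=> /MG/andP[/eqP-> _]; rewrite (maxn_idPl km) (minn_idPr km).
have dimB : \dim (G a) - \dim (G delta) = m * (delta - a).
  by rewrite !dimG // -mulnBr; congr (_ * _); lia.
(* The nonzero words of [G a] whose rank is small enough for the second lifting. *)
pose S := [set M in G a | 1 <= \rank M < (k - delta).+1].
have SG : {subset S <= G a} by move=> M; rewrite inE => /andP[].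
(* A nonzero word of [G delta] has rank at least [delta], whereas here the rank is at most
   [k - delta < delta]. *)
have SnG M : M \in S -> M \notin G delta.
  rewrite inE => /andP[_ rM]; apply/negP => MGd.
  have := MRD_dist (A := M) (B := 0%R) MD; rewrite subr0 -mxrank_eq0 => /(_ MGd).
  lia.
(* Differences inside a coset of [G delta] lie in [G delta], which gives [X] rank distance
   [delta]. *)
have [|X [XS Xdiff cardS]] := exists_large_coset (GS _ _ (ltnW ad)) _ SG SnG.
  by rewrite -subn_gt0 dimB muln_gt0; lia.
apply: (@leq_trans (base + #|X|)).
  rewrite leq_add2l sumA // -/S -natrX; apply: abs_ceil_ratio_le.
    by rewrite -(exp1n (m * (delta - a))) ltn_exp2r ?finNzRing_gt1 // muln_gt0; lia.
  by rewrite -dimB.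
apply: (barA_ge_tr hn dk MD) => [M N MX NX|M /(subsetP XS)].
  by apply: (MRD_dist MD); apply: Xdiff.
by rewrite inE => /and3P[].
Qed.
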